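(* For each integer $n\ge 1$ let $h_n(z)=\sum_{j=0}^{n-1}\sum_{k=0}^{n-1}e^{2\pi i jk/n}\,z^{nj+k}$. Then \[ \lim_{n\to\infty}\frac{\lVert h_n\rVert_4^4-\lVert h_n\rVert_2^4}{\lVert h_n\rVert_2^3}=\frac{4}{\pi^2}. \]
   Context: For real $r\ge 1$, the $L^r$ norm of a polynomial $f\in\mathbb{C}[z]$ on the unit circle is \[ \lVert f\rVert_r=\bigg(\frac{1}{2\pi}\int_0^{2\pi}\lvert f(e^{i\theta})\rvert^r\,d\theta\bigg)^{1/r}. \] In the definition of $h_n$, $i$ denotes the imaginary unit and $j,k$ are summation indices. *)

(* Defs.v *)
From mathcomp Require Import all_boot all_order all_algebra.
From mathcomp Require Import all_classical all_reals all_analysis.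
From mathcomp Require Import complex.

Set Implicit Arguments.
Unset Strict Implicit.
Unset Printing Implicit Defensive.

Import Order.TTheory GRing.Theory Num.Theory.
Import numFieldNormedType.Exports.

Local Open Scope classical_set_scope.
Local Open Scope ring_scope.
Local Open Scope complex_scope.

(* The libraries have no complex exponential: e^(i t) by Euler's formula. *)
Definition expi (R : realType) (t : R) : R[i] := cos t +i* sin t.

(* Meant for r >= 1. The absolute value is normc, valued in R, because the
   generic norm on R[i] is valued in R[i]. *)
Definition circle_norm (R : realType) (r : R) (f : {poly R[i]}) : R :=
  ((2 * pi)^-1 *
     (\int[lebesgue_measure]_(t in `[0, 2 * pi])
        (Normc.normc f.[expi t] `^ r))%R) `^ r^-1.

Definition h (R : realType) (n : nat) : {poly R[i]} :=
  \sum_(0 <= j < n) \sum_(0 <= k < n)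
    expi (2 * pi * (j * k)%:R / n%:R) *: 'X^(n * j + k).

(* Main.v *)
(* The norms are read off coefficients: ||f||_2^2 is the sum of |f_m|^2, and for
   f of degree at most M, |f|^2 equals |f f~| on the circle, where
   f~ = sum_m conj(f_(M-m)) z^m, so ||f||_4^4 is the sum of the squared moduli of
   the coefficients of f f~, which are the aperiodic autocorrelations C_u of f and
   their conjugates.  For h_n, with zeta = e^(2 pi i/n), x = zeta^t, 0 <= s, t < n
   and u = ns + t <> 0, geometric sums give
     C_u = c_s V_s(x) - c_(s+1) V_(s+1)(x),
   where c_s = 1/(zeta^s - 1) and V_s(x) = x^-s (x^s - 1) (1 + ... + x^(s-1)).
   When 2s + 2 <= n, x^(s+1) C_u is a polynomial in x with at most n terms, so
   Parseval on the n-th roots of unity evaluates the sum over t of |C_u|^2 as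
   n (2 |c_(s+1)|^2 + 2s |c_s - c_(s+1)|^2); the symmetry V_(n-s) = V_s reduces the
   other s to these.  As |c_s| = 1/(2 sin(pi s/n)), replacing sin y by y turns
   (||h_n||_4^4 - n^4) / n^3 into
     2/pi^2 (1 + sum_(s >= 1) 1/(s(s+1))) = 4/pi^2,
   and 1/y^2 <= 1/sin^2 y <= 1/y^2 + 1 on (0, pi/2] makes the error O(1/n). *)

Require Import Defs.
From mathcomp Require Import all_boot all_order all_algebra.
From mathcomp Require Import all_classical all_reals all_analysis.
From mathcomp Require Import complex.
From mathcomp Require Import ring lra zify.

Import Order.TTheory GRing.Theory Num.Theory.
Import numFieldNormedType.Exports.

Local Open Scope classical_set_scope.
Local Open Scope ring_scope.

(** * Geometric sums and the functions V_s at roots of unity *)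

Definition geom {C : numClosedFieldType} (x : C) (m : nat) : C :=
  \sum_(i < m) x ^+ i.

(* On the unit circle this is (1 - x^-1) |geom x s|^2. *)
Definition fejer {C : numClosedFieldType} (x : C) (s : nat) : C :=
  x ^- s * (x ^+ s - 1) * geom x s.

Lemma geomM1 {C : numClosedFieldType} (x : C) m :
  (x - 1) * geom x m = x ^+ m - 1.
Proof. by rewrite subrX1. Qed.

Lemma geomD {C : numClosedFieldType} (x : C) m p :
  geom x (m + p) = geom x m + x ^+ m * geom x p.
Proof.
rewrite /geom big_split_ord /= mulr_sumr; congr (_ + _).
by apply: eq_bigr => i _; rewrite exprD.
Qed.

Lemma geom_root {C : numClosedFieldType} (x : C) n :
  x ^+ n = 1 -> x != 1 -> geom x n = 0.
Proof.
move=> xn x1; apply: (mulfI (x := x - 1)); first by rewrite subr_eq0.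
by rewrite geomM1 xn subrr mulr0.
Qed.

Lemma fejer1 {C : numClosedFieldType} s : fejer (1 : C) s = 0.
Proof. by rewrite /fejer expr1n subrr mulr0 mul0r. Qed.

Lemma root_neq0 {C : numClosedFieldType} (x : C) n :
  (0 < n)%N -> x ^+ n = 1 -> x != 0.
Proof.
move=> n0 xn; apply/eqP => x0; move: xn; rewrite x0 expr0n eqn0Ngt n0 => /eqP.
by rewrite eq_sym oner_eq0.
Qed.

Lemma root_expB {C : numClosedFieldType} (x : C) n s :
  (0 < n)%N -> x ^+ n = 1 -> (s <= n)%N -> x ^+ (n - s) = x ^- s.
Proof.
move=> n0 xn sn; have xs0 : x ^+ s != 0 by rewrite expf_neq0 ?(root_neq0 x n).
by apply: (mulIf xs0); rewrite -exprD subnK // xn mulVf.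
Qed.

(** The full sum [geom x n] vanishes; cut it after n - s terms and use x^(n-s) = x^-s. *)
Lemma geom_compl {C : numClosedFieldType} (x : C) n s :
  (0 < n)%N -> x ^+ n = 1 -> x != 1 -> (s <= n)%N ->
  geom x (n - s) = - (x ^- s * geom x s).
Proof.
move=> n0 xn x1 sn.
have := geom_root x n xn x1; rewrite -{1}(subnK sn) geomD => /eqP.
by rewrite addr_eq0 => /eqP ->; rewrite root_expB.
Qed.

(** The sign from [geom_compl] cancels that of x^-s - 1 = -x^-s (x^s - 1); at x = 1 both sides
    vanish. *)
Lemma fejer_compl {C : numClosedFieldType} (x : C) n s :
  (0 < n)%N -> x ^+ n = 1 -> (s <= n)%N -> fejer x (n - s) = fejer x s.
Proof.
move=> n0 xn sn; have [->|x1] := eqVneq x 1; first by rewrite !fejer1.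
rewrite /fejer (geom_compl x n) // root_expB //.
by field; rewrite expf_neq0 ?(root_neq0 x n).
Qed.

Lemma root_norm1 {C : numClosedFieldType} (x : C) n :
  (0 < n)%N -> x ^+ n = 1 -> `|x| = 1.
Proof.
move=> n0 xn; apply/eqP; rewrite -(pexpr_eq1 n0) ?normr_ge0 //.
by rewrite -normrX xn normr1.
Qed.

Lemma norm1_conj {C : numClosedFieldType} (x : C) : `|x| = 1 -> x^* = x^-1.
Proof. by move=> x1; rewrite invC_norm x1 expr1n invr1 mul1r. Qed.

(** * Parseval on the n-th roots of unity *)

(** Expand the square and exchange sums: the sum over t of w^t with w = z^(k-l) is n for k = l, and
    a vanishing full geometric sum otherwise. *)
Lemma discrete_parseval {C : numClosedFieldType} (z : C) n m (b : nat -> C) :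
  n.-primitive_root z -> (m <= n)%N ->
  \sum_(t < n) `|\sum_(k < m) b k * (z ^+ t) ^+ k| ^+ 2 =
  n%:R * \sum_(k < m) `|b k| ^+ 2.
Proof.
move=> zn mn.
have n0 : (0 < n)%N := prim_order_gt0 zn.
have z1 : `|z| = 1 by apply: root_norm1 n0 (prim_expr_order zn).
have orth (k l : 'I_m) : \sum_(t < n) (z ^+ t) ^+ k * ((z ^+ t) ^+ l)^* =
    n%:R *+ (k == l).
  set w := z ^+ k * (z ^+ l)^*.
  have zl : (z ^+ l)^* = (z ^+ l)^-1 by rewrite norm1_conj // normrX z1 expr1n.
  have zl0 : z ^+ l != 0 by rewrite -normr_eq0 normrX z1 expr1n oner_eq0.
  rewrite (eq_bigr (fun t : 'I_n => w ^+ t)); last first.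
    move=> t _; rewrite exprMn -!exprM ![(t * _)%N]mulnC; congr (_ * _).
    by rewrite !exprM rmorphXn.
  have [kl|kl] := eqVneq k l.
    rewrite (eq_bigr (fun=> 1)) ?sumr_const ?card_ord ?mulr1n // => t _.
    by rewrite /w zl kl divff // expr1n.
  rewrite mulr0n; apply: (geom_root w n).
    rewrite exprMn -rmorphXn /= -!exprM ![(_ * n)%N]mulnC !exprM.
    by rewrite (prim_expr_order zn) !expr1n rmorph1 mulr1.
  apply/negP => /eqP w1; move/negP: kl; apply.
  have : z ^+ k == z ^+ l.
    by move: w1; rewrite /w zl => /(congr1 ( *%R^~ (z ^+ l)));
       rewrite divfK // mul1r => ->.
  (* As m <= n, the exponents stay below n, where the powers of z are distinct. *)
  rewrite (eq_prim_root_expr zn) !modn_small //;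
    by rewrite (leq_trans (ltn_ord _) mn).
under eq_bigr => t _.
  rewrite normCK rmorph_sum mulr_suml.
  under eq_bigr do rewrite mulr_sumr.
  over.
rewrite exchange_big mulr_sumr; apply: eq_bigr => k _ /=.
rewrite exchange_big (bigD1 k) //= [X in _ + X]big1 ?addr0.
  have := orth k k; rewrite eqxx mulr1n => <-.
  rewrite normCK mulr_suml; apply: eq_bigr => t _; rewrite rmorphM; ring.
move=> l lk.
rewrite (eq_bigr (fun t : 'I_n => b k * (b l)^* *
   ((z ^+ t) ^+ k * ((z ^+ t) ^+ l)^*))).
  by rewrite -mulr_sumr orth eq_sym (negbTE lk) mulr0n mulr0.
by move=> t _; rewrite rmorphM; ring.
Qed.

(** x^(r+1) V_(r+1) = (x^(r+1) - 1)(1 + ... + x^r) has r + 1 coefficients -1 followed by r + 1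
    coefficients 1; x^(r+1) V_r is the same pattern for r, shifted by one. The combination has
    coefficients b, then b - a and a - b (r times each), then -b. *)
Lemma fejer_pair_expansion {C : numClosedFieldType} (x a b : C) r : x != 0 ->
  x ^+ r.+1 * (a * fejer x r - b * fejer x r.+1) =
  \sum_(k < r.+1 + r.+1)
    (if (k <= r)%N then if k == 0%N :> nat then b else b - a
     else if k == (r + r).+1 :> nat then - b else a - b) * x ^+ k.
Proof.
move=> x0; rewrite big_split_ord /= big_ord_recl big_ord_recr /=.
rewrite addSn eqxx ltnNge leq_addr /= !expr0 mulr1.
rewrite (eq_bigr (fun i : 'I_r => (b - a) * x * x ^+ i)); last first.
  by move=> i _; rewrite /bump /= !add1n ltn_ord exprS mulrA.
rewrite [X in _ = _ + (X + _)](eq_bigr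
   (fun i : 'I_r => (a - b) * x ^+ r.+1 * x ^+ i)); last first.
  move=> i _; rewrite addSn ltnNge leq_addr /= eqSS eqn_add2l.
  by rewrite (ltn_eqF (ltn_ord i)) -addSn exprD mulrA.
rewrite -!mulr_sumr -/(geom x r).
have G1 : geom x r.+1 = geom x r + x ^+ r by rewrite /geom big_ord_recr.
have G2 : geom x r.+1 = 1 + x * geom x r.
  by rewrite -add1n geomD /geom big_ord1 expr0 expr1.
have H : x ^+ r.+1 * (a * fejer x r - b * fejer x r.+1) =
   a * x * (x ^+ r - 1) * geom x r
     - b * (x ^+ r.+1 * geom x r.+1 - geom x r.+1).
  rewrite /fejer exprS; field; by rewrite x0 expf_neq0.
by rewrite H {1}G1 G2 exprS exprS exprD; ring.
Qed.

(** The factor x^(r+1) has modulus 1, and [fejer_pair_expansion] gives 2r + 2 <= n coefficients: two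
    of modulus |b| and 2r of modulus |a - b|. *)
Lemma fejer_pair_parseval {C : numClosedFieldType} (z a b : C) n r :
  n.-primitive_root z -> (r.+1 + r.+1 <= n)%N ->
  \sum_(t < n) `|a * fejer (z ^+ t) r - b * fejer (z ^+ t) r.+1| ^+ 2 =
  n%:R * (`|b| ^+ 2 *+ 2 + `|a - b| ^+ 2 *+ (2 * r)).
Proof.
move=> zn rn.
have n0 : (0 < n)%N := prim_order_gt0 zn.
have z1 : `|z| = 1 by apply: root_norm1 n0 (prim_expr_order zn).
have zt1 t : `|z ^+ t| = 1 by rewrite normrX z1 expr1n.
have E t : `|a * fejer (z ^+ t) r - b * fejer (z ^+ t) r.+1| =
  `|(z ^+ t) ^+ r.+1 * (a * fejer (z ^+ t) r - b * fejer (z ^+ t) r.+1)|.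
  by rewrite normrM normrX zt1 expr1n mul1r.
under eq_bigr => t _.
  rewrite E fejer_pair_expansion; last by rewrite -normr_eq0 zt1 oner_eq0.
  over.
rewrite (discrete_parseval _ _ _ (fun k => if (k <= r)%N then
   if k == 0%N :> nat then b else b - a
     else if k == (r + r).+1 :> nat then - b else a - b) zn rn) /=.
congr (_ * _).
rewrite big_split_ord /= big_ord_recl big_ord_recr /=.
rewrite addSn eqxx ltnNge leq_addr /=.
rewrite (eq_bigr (fun i : 'I_r => `|a - b| ^+ 2)); last first.
  by move=> i _; rewrite /bump /= !add1n ltn_ord distrC.
rewrite [X in _ + (X + _) = _](eq_bigr (fun i : 'I_r => `|a - b| ^+ 2)); last first.
  move=> i _; rewrite addSn ltnNge leq_addr /= eqSS eqn_add2l.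
  by rewrite (ltn_eqF (ltn_ord i)).
by rewrite !sumr_const card_ord normrN mul2n -addnn mulrnDr mulr2n; ring.
Qed.

(** * Autocorrelations of the coefficients of h_n *)

Lemma sum_blocks {V : nmodType} (F : nat -> V) p n :
  \sum_(m < p * n) F m = \sum_(j < p) \sum_(k < n) F (n * j + k)%N.
Proof.
elim: p => [|p IH]; first by rewrite mul0n !big_ord0.
rewrite mulSnr big_split_ord /= IH big_ord_recr /=; congr (_ + _).
by apply: eq_bigr => k _; rewrite mulnC.
Qed.

Lemma sum_ord_shift_lt {V : nmodType} (F : nat -> V) n s :
  \sum_(j < n) (if (j + s < n)%N then F j else 0) = \sum_(j < n - s) F j.
Proof.
rewrite -big_mkcond /= (big_ord_widen_cond n xpredT F (leq_subr s n)) /=.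
by apply: eq_bigl => j; rewrite ltn_subRL addnC.
Qed.

(** The sequences used vanish from N on, which makes this the aperiodic autocorrelation C_u although
    m runs up to N - 1. *)
Definition acorr {C : numClosedFieldType} (a : nat -> C) (N u : nat) : C :=
  \sum_(m < N) a (m + u)%N * (a m)^*.

(** The coefficients of h_n when z = e^(2 pi i/n): j and k are the base-n digits of m. Extension by
    zero allows shifted indices. *)
Definition gauss_seq {C : numClosedFieldType} (z : C) (n m : nat) : C :=
  if (m < n * n)%N then z ^+ ((m %/ n) * (m %% n)) else 0.

(** The c_s of the overview. For z of order n, the default 0^-1 = 0 gives the value 0 at s = 0 and s
    = n. *)
Definition pole {C : numClosedFieldType} (z : C) (s : nat) : C := (z ^+ s - 1)^-1.

Lemma gauss_seqE {C : numClosedFieldType} (z : C) n j k : (k < n)%N ->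
  gauss_seq z n (n * j + k) = if (j < n)%N then z ^+ (j * k) else 0.
Proof.
move=> kn; have n0 : (0 < n)%N by rewrite (leq_trans _ kn).
rewrite /gauss_seq mulnC divnMDl // modnMDl divn_small // modn_small // addn0.
have [jn|nj] := ltnP j n; last first.
  by rewrite ifF //; apply/negbTE; rewrite -leqNgt (leq_trans _ (leq_addr _ _)) //
    leq_mul2r nj orbT.
rewrite ifT //; apply: (@leq_trans (j.+1 * n)%N); first by rewrite mulSnr ltn_add2l.
by rewrite leq_mul2r jn orbT.
Qed.

(** Adding ns + t to nj + k in base n gives digits (j + s, k + t), or (j + s + 1, k + t - n) after a
    carry. Each case is a product of a geometric sum over j and one over k; the case without carry
    gives the V_s term, the other the V_(s+1) term. *)
Lemma acorr_gauss {C : numClosedFieldType} (z : C) n s t :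
  n.-primitive_root z -> (s < n)%N -> (t < n)%N -> (0 < n * s + t)%N ->
  acorr (gauss_seq z n) (n * n) (n * s + t) =
  pole z s * fejer (z ^+ t) s - pole z s.+1 * fejer (z ^+ t) s.+1.
Proof.
move=> zn sn tn u0.
have n0 : (0 < n)%N := prim_order_gt0 zn.
have z1n := prim_expr_order zn.
have zne : z != 0 := root_neq0 z n n0 z1n.
have zV j : (z ^+ j)^* = z ^- j.
  by rewrite norm1_conj // normrX (root_norm1 z n) // expr1n.
have rn j : (z ^+ j) ^+ n = 1 by rewrite -exprM mulnC exprM z1n expr1n.
set x := z ^+ t.
rewrite /acorr (sum_blocks (fun m => gauss_seq z n (m + (n * s + t)) *
  (gauss_seq z n m)^*)).
have -> : \sum_(j < n) \sum_(k < n) gauss_seq z n (n * j + k + (n * s + t)) *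
     (gauss_seq z n (n * j + k))^* =
   \sum_(j < n) ((if (j + s < n)%N then x ^+ s * x ^+ j * geom (z ^+ s) (n - t)
      else 0) + (if (j + s.+1 < n)%N then x ^+ j * geom (z ^+ s.+1) t else 0)).
  apply: eq_bigr => j _.
  have nE : n = (n - t + t)%N by rewrite subnK // ltnW.
  rewrite -(big_mkord xpredT (fun k => gauss_seq z n (n * j + k + (n * s + t)) *
     (gauss_seq z n (n * j + k))^*)).
  (* A carry occurs exactly for k >= n - t. *)
  rewrite (big_cat_nat (n := n - t)) ?leq_subr //=; congr (_ + _).
    rewrite big_mkord /geom.
    case: ifP => js; last first.
      apply: big1 => k _.
      rewrite (_ : (_ + _ + _)%N = (n * (j + s) + (k + t))%N); last ring.
      by rewrite gauss_seqE ?js ?mul0r // addnC -ltn_subRL.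
    rewrite mulr_sumr; apply: eq_bigr => k _.
    have kt : (k + t < n)%N by rewrite addnC -ltn_subRL.
    rewrite (_ : (_ + _ + _)%N = (n * (j + s) + (k + t))%N); last ring.
    rewrite !gauss_seqE ?js ?ltn_ord //; last first.
      by rewrite (leq_ltn_trans (leq_addr _ _) kt).
    rewrite zV; apply: (mulIf (x := z ^+ (j * k))); first exact: expf_neq0.
    rewrite divfK ?expf_neq0 // /x -!exprM -!exprD; congr (_ ^+ _); ring.
  rewrite -{1}[(n - t)%N]add0n big_addn subKn ?(ltnW tn) // big_mkord.
  case: ifP => js; last first.
    apply: big1 => k _.
    rewrite (_ : (_ + _ + _)%N = (n * (j + s.+1) + k)%N); last first.
      by rewrite addnA -[in RHS]addn1 !mulnDr muln1; lia.
    by rewrite gauss_seqE ?js ?mul0r // (ltn_trans (ltn_ord k)).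
  rewrite mulr_sumr; apply: eq_bigr => k _.
  have kt := ltn_ord k.
  rewrite (_ : (_ + _ + _)%N = (n * (j + s.+1) + k)%N); last first.
    by rewrite addnA -[in RHS]addn1 !mulnDr muln1; lia.
  rewrite !gauss_seqE ?js ?ltn_ord //; [|lia|lia].
  rewrite zV; apply: (mulIf (x := z ^+ (j * (k + (n - t))))).
    exact: expf_neq0.
  rewrite divfK ?expf_neq0 // /x -!exprM -!exprD.
  (* After a carry the exponents agree only modulo n: they differ by j n. *)
  apply/eqP; rewrite (eq_prim_root_expr zn); apply/eqP.
  rewrite (_ : (t * j + s.+1 * k + _)%N = (j * n + (j + s.+1) * k)%N).
    by rewrite modnMDl.
  have -> : (j * n = j * t + j * (n - t))%N by rewrite -mulnDr subnKC // ltnW.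
  ring.
rewrite big_split /= (sum_ord_shift_lt
  (fun j => x ^+ s * x ^+ j * geom (z ^+ s) (n - t))).
rewrite (sum_ord_shift_lt (fun j => x ^+ j * geom (z ^+ s.+1) t)).
rewrite -!mulr_suml -mulr_sumr -/(geom x (n - s)) -/(geom x (n - s.+1)).
have xn : x ^+ n = 1 by exact: rn.
(* For t = 0 there is no carry, and s > 0 because u > 0, so [geom (z ^+ s) n] vanishes; on the right
   both V vanish at x = 1. *)
have [t0|t0] := posnP t.
  have -> : geom (z ^+ s.+1) t = 0 by rewrite t0 /geom big_ord0.
  have -> : geom (z ^+ s) (n - t) = 0.
    rewrite t0 subn0 geom_root ?rn // -(expr0 z) (eq_prim_root_expr zn).
    rewrite mod0n modn_small //; apply: contraL u0 => /eqP ->.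
    by rewrite t0 muln0.
  by rewrite /x t0 expr0 !fejer1 !mulr0 subr0 addr0.
have x1 : x != 1.
  by rewrite -(expr0 z) (eq_prim_root_expr zn) mod0n modn_small // -lt0n.
congr (_ + _).
  rewrite geom_compl ?(ltnW sn) // /fejer /pole.
  have [->|s0] := posnP s; first by rewrite /geom !big_ord0 !(mulr0, oppr0, mul0r).
  have y1 : z ^+ s - 1 != 0.
    by rewrite subr_eq0 -(expr0 z) (eq_prim_root_expr zn) mod0n modn_small // -lt0n.
  (* Multiplying by z^s - 1 turns the sum over k into z^(s(n-t)) - 1 = x^-s - 1. *)
  apply: (mulfI y1); rewrite mulrCA geomM1 root_expB ?rn ?(ltnW tn) //.
  have -> : (z ^+ s) ^+ t = x ^+ s by rewrite -!exprM mulnC.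
  field; rewrite y1 expf_neq0 //; exact: expf_neq0.
(* At s + 1 = n the sum over j is empty and [pole z n] is 0 by default. *)
have [s1|s1] := ltnP s.+1 n; last first.
  have -> : s.+1 = n by apply/eqP; rewrite eqn_leq s1 sn.
  by rewrite subnn /pole z1n subrr invr0 mul0r oppr0 /geom big_ord0 mul0r.
have y1 : z ^+ s.+1 - 1 != 0.
  by rewrite subr_eq0 -(expr0 z) (eq_prim_root_expr zn) mod0n modn_small.
rewrite geom_compl // /fejer /pole.
apply: (mulfI y1); rewrite mulrCA geomM1.
have -> : (z ^+ s.+1) ^+ t = x ^+ s.+1 by rewrite -!exprM mulnC.
field; rewrite y1 expf_neq0 //; exact: expf_neq0.
Qed.

(** [acorr_gauss] excludes u = 0; the double sum still keeps s = t = 0, since that entry is 0 by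
    V_s(1) = 0. *)
Lemma sum_sqr_acorr_gauss {C : numClosedFieldType} (z : C) n :
  n.-primitive_root z ->
  \sum_(u < n * n) `|acorr (gauss_seq z n) (n * n) u| ^+ 2 =
  `|acorr (gauss_seq z n) (n * n) 0| ^+ 2 +
  \sum_(s < n) \sum_(t < n)
    `|pole z s * fejer (z ^+ t) s - pole z s.+1 * fejer (z ^+ t) s.+1| ^+ 2.
Proof.
move=> zn; rewrite (sum_blocks (fun u => `|acorr (gauss_seq z n) (n * n) u| ^+ 2)).
case: n zn => [|n] zn; first by have := prim_order_gt0 zn.
rewrite big_ord_recl [in RHS]big_ord_recl /= addrA.
congr (_ + _); last first.
  apply: eq_bigr => s _; apply: eq_bigr => t _.
  by rewrite (acorr_gauss z n.+1 (lift ord0 s) t).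
rewrite big_ord_recl [in RHS]big_ord_recl /= muln0.
rewrite expr0 !fejer1 !mulr0 subr0 normr0 expr0n /= add0r; congr (_ + _).
apply: eq_bigr => t _.
have := acorr_gauss z n.+1 0%N (lift ord0 t) zn isT (ltn_ord _).
by rewrite muln0 => ->.
Qed.

Lemma pole_compl {C : numClosedFieldType} (z : C) n s :
  n.-primitive_root z -> (s <= n)%N -> pole z (n - s) = (pole z s)^*.
Proof.
move=> zn sn; have n0 := prim_order_gt0 zn; have z1n := prim_expr_order zn.
have z1 : `|z| = 1 by apply: root_norm1 n0 z1n.
rewrite /pole root_expB // fmorphV rmorphB rmorph1 /=.
by rewrite norm1_conj // normrX z1 expr1n.
Qed.

(** Rows r and n - r - 1 are equal by symmetry, which doubles the factor 2 of [fejer_pair_parseval]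
    to 4. An odd n leaves one unpaired row s = n./2. *)
Lemma sum_rows_gauss {C : numClosedFieldType} (z : C) n :
  n.-primitive_root z ->
  \sum_(s < n) \sum_(t < n)
    `|pole z s * fejer (z ^+ t) s - pole z s.+1 * fejer (z ^+ t) s.+1| ^+ 2 =
  n%:R * (\sum_(r < n./2)
     (`|pole z r.+1| ^+ 2 + `|pole z r - pole z r.+1| ^+ 2 *+ r) *+ 4 +
    (`|pole z n./2 - pole z n./2.+1| ^+ 2 *+ n./2.*2) *+ odd n).
Proof.
move=> zn; have n0 := prim_order_gt0 zn; have z1n := prim_expr_order zn.
have rn j : (z ^+ j) ^+ n = 1 by rewrite -exprM mulnC exprM z1n expr1n.
set row := fun s => \sum_(t < n)
    `|pole z s * fejer (z ^+ t) s - pole z s.+1 * fejer (z ^+ t) s.+1| ^+ 2.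
set m := n./2.
have nE : n = (m + odd n + m)%N by rewrite addnAC addnn addnC odd_double_half.
have low r : (r < m)%N -> row r =
    n%:R * ((`|pole z r.+1| ^+ 2 + `|pole z r - pole z r.+1| ^+ 2 *+ r) *+ 2).
  move=> rm; rewrite /row fejer_pair_parseval //; last by lia.
  by rewrite mulrnDl -mulrnA [(r * 2)%N]mulnC.
have high r : (r < m)%N -> row (n - r.+1)%N = row r.
  move=> rm; rewrite (low r) // /row.
  have rS : (n - r.+1).+1 = (n - r)%N by lia.
  rewrite rS; under eq_bigr => t _.
    rewrite !fejer_compl //; [|lia|lia].
    rewrite distrC; over.
  rewrite fejer_pair_parseval //; last by lia.
  rewrite !(pole_compl _ n) //; [|lia|lia].
  by rewrite -rmorphB !norm_conjC mulrnDl -mulrnA [(r * 2)%N]mulnC.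
(* With n = 2m + 1 the pair has 2m + 2 > n coefficients, too many for Parseval; but V_(m+1) =
   V_(n-m) = V_m, so c_m - c_(m+1) factors out. *)
have mid : odd n -> row m = n%:R * (`|pole z m - pole z m.+1| ^+ 2 *+ m.*2).
  move=> on; have mS : m.+1 = (n - m)%N by move: nE; rewrite on; lia.
  rewrite /row; under eq_bigr => t _.
    rewrite mS fejer_compl //; last by lia.
    rewrite -mS -mulrBl normrM exprMn; over.
  rewrite -mulr_sumr /=.
  have -> : \sum_(t < n) `|fejer (z ^+ t) m| ^+ 2 = n%:R * m.*2%:R.
    case: (m) nE => [|k] nE.
      rewrite double0 mulr0 big1 // => t _.
      by rewrite /fejer expr0 subrr mulr0 mul0r normr0 expr0n.
    (* Taking a = 0, b = 1 and r = m - 1 isolates V_m. *)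
    have := fejer_pair_parseval z 0 1 n k zn.
    rewrite normr1 sub0r normrN normr1 expr1n => H.
    under eq_bigr => t _ do
      rewrite -normrN -[fejer _ _]mul1r -sub0r -[0](mul0r (fejer (z ^+ t) k)).
    rewrite H; last by move: nE; rewrite on; lia.
    by rewrite -mulrnDr -mul2n mulnS.
  by rewrite -mulr_natr; ring.
rewrite -/(row _) -(big_mkord xpredT row).
have split : \sum_(0 <= s < n) row s =
   \sum_(0 <= s < m) row s + (row m *+ odd n + \sum_(0 <= s < m) row s).
  have mn : (m <= n)%N by rewrite nE -addnA leq_addr.
  rewrite (big_cat_nat (n := m)) //=; congr (_ + _).
  have mo : (m + odd n <= n)%N by rewrite [X in (_ <= X)%N]nE leq_addr.
  rewrite (big_cat_nat (n := m + odd n)) ?leq_addr //=; congr (_ + _).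
    case: (odd n); first by rewrite addn1 big_nat1 mulr1n.
    by rewrite addn0 big_geq.
  rewrite -{1}[(m + odd n)%N]add0n big_addn.
  have -> : (n - (m + odd n) = m)%N by rewrite {1}nE addnC addnK.
  rewrite big_nat_rev /= big_nat [RHS]big_nat; apply: eq_bigr => r rm.
  rewrite -(high r); last by case/andP: rm.
  congr (row _); move: rm nE; move: (nat_of_bool (odd n)) => o; lia.
rewrite split mulrDr; rewrite addrCA [RHS]addrC.
congr (_ + _).
  by case: (odd n) mid => [->//|_]; rewrite !mulr0n mulr0.
rewrite -mulr2n big_mkord mulr_sumr -sumrMnl; apply: eq_bigr => r _.
by rewrite low // -mulrnAr -mulrnA.
Qed.

(** * The complex exponential and Parseval on the circle *)

Lemma expiD (R : realType) (s t : R) : expi (s + t) = expi s * expi t.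
Proof. by rewrite /expi cosD sinD; congr (Complex _ _); rewrite addrC mulrC. Qed.

Lemma expi0 (R : realType) : expi 0 = 1 :> R[i].
Proof. by rewrite /expi cos0 sin0. Qed.

Lemma expiX (R : realType) (t : R) k : expi t ^+ k = expi (k%:R * t).
Proof.
elim: k => [|k IH]; first by rewrite mul0r expi0.
by rewrite exprS IH -expiD -natr1 mulrDl mul1r addrC.
Qed.

Lemma conj_expi (R : realType) (t : R) : (expi t)^* = expi (- t).
Proof. by rewrite /expi cosN sinN. Qed.

Lemma expi2pi (R : realType) : expi (2 * pi) = 1 :> R[i].
Proof. by rewrite /expi mulr_natl cos2pi sin2pi. Qed.

Lemma sqr_normcE (R : realType) (z : R[i]) :
  (Normc.normc z ^+ 2)%:C%C = `|z| ^+ 2.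
Proof. by rewrite rmorphXn. Qed.

Lemma sqr_normc_Re (R : realType) (z : R[i]) :
  Normc.normc z ^+ 2 = complex.Re (z * z^*).
Proof. by rewrite -normCK -sqr_normcE. Qed.

Lemma Re_sum (R : realType) I (r : seq I) (P : pred I) (F : I -> R[i]) :
  complex.Re (\sum_(i <- r | P i) F i) = \sum_(i <- r | P i) complex.Re (F i).
Proof. by apply: big_morph => // -[a b] [c d]. Qed.

Lemma normc_ge0 (R : realType) (z : R[i]) : 0 <= Normc.normc z.
Proof. by case: z => a b; exact: sqrtr_ge0. Qed.

(** Carrying an explicit antiderivative makes the notion stable under finite sums and reduces
    integration to the fundamental theorem of calculus. *)
Definition has_circle_integral (R : realType) (f : R -> R) (v : R) :=
  continuous f /\
  exists2 F : R -> R, forall t : R, is_derive t 1 F (f t) & F (2 * pi) - F 0 = v.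

Lemma has_circle_integralE (R : realType) (f : R -> R) v :
  has_circle_integral R f v ->
  \int[lebesgue_measure]_(t in `[0, 2 * pi]) f t = v.
Proof.
move=> [cf [F dF <-]]; rewrite /Rintegral.
rewrite (@continuous_FTC2 _ f F) //.
- by rewrite mulr_gt0 // pi_gt0.
- exact: continuous_subspaceT.
- have cF : continuous F.
    move=> t; apply: differentiable_continuous; apply/derivable1_diffP.
    by have [] := dF t.
  split=> [t _||]; first by have [] := dF t.
  + by apply: cvg_at_right_filter; exact: cF.
  + by apply: cvg_at_left_filter; exact: cF.
- by move=> t _; rewrite derive1E; have [_ ->] := dF t.
Qed.

Lemma has_circle_integral_sum (R : realType) I (r : seq I) (P : pred I)
    (f : I -> R -> R) (v : I -> R) :
  (forall i, P i -> has_circle_integral R (f i) (v i)) ->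
  has_circle_integral R (fun t => \sum_(i <- r | P i) f i t)
    (\sum_(i <- r | P i) v i).
Proof.
move=> H; elim: r => [|i r [cf [F dF Fv]]].
  split; first by under eq_fun do rewrite big_nil; exact: cst_continuous.
  exists (fun=> 0); last by rewrite subrr big_nil.
  by move=> t; rewrite big_nil; exact: is_derive_cst.
have -> : (fun t => \sum_(j <- i :: r | P j) f j t) = (fun t => if P i
    then f i t + \sum_(j <- r | P j) f j t else \sum_(j <- r | P j) f j t).
  by apply/funext => t; rewrite big_cons.
rewrite big_cons; case: ifP => [Pi|_]; last by split=> //; exists F.
have [ci [G dG Gv]] := H i Pi.
split; first by move=> t; apply: cvgD; [exact: ci|exact: cf].
exists (G \+ F); last by rewrite /= -Fv -Gv; ring.
by move=> t; exact: is_deriveD.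
Qed.

(** Orthogonality of exponentials, in the form met when |g|^2 is expanded: frequencies are
    differences p - q, and real parts keep the integrand in R. *)
Lemma has_circle_integral_expi (R : realType) (w : R[i]) (p q : nat) :
  has_circle_integral R
    (fun t => complex.Re (w * expi ((p%:R - q%:R) * t)))
    ((2 * pi * complex.Re w) *+ (p == q)).
Proof.
case: w => a b; set k : R := p%:R - q%:R.
have -> : (fun t => complex.Re (a +i* b * expi (k * t))%C) =
  (fun t => a * cos (k * t) - b * sin (k * t)) by [].
split.
  move=> t; apply: cvgB; apply: cvgM; [exact: cvg_cst| |exact: cvg_cst|];
    apply: (@continuous_comp _ _ _ ( *%R k)).
  - exact: mulrl_continuous.
  - exact: continuous_cos.
  - exact: mulrl_continuous.
  - exact: continuous_sin.
have [pq|pq] := eqVneq p q.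
  exists (fun t => a * t); last by rewrite /=; ring.
  move=> t; rewrite /k pq subrr mul0r cos0 sin0 mulr0 subr0.
  apply: is_derive_eq.
  by rewrite /GRing.scale /=; ring.
have k0 : k != 0 by rewrite subr_eq0 eqr_nat.
exists (fun t => k^-1 * (a * sin (k * t) + b * cos (k * t))).
  move=> t; apply: is_derive_eq.
  by rewrite /GRing.scale /=; field.
(* As k is an integer, the antiderivative agrees at 0 and 2 pi. *)
have e1 : expi (k * (2 * pi)) = 1.
  rewrite /k mulrBl expiD -conj_expi -(expiX _ (2 * pi) p).
  rewrite -(expiX _ (2 * pi) q) expi2pi !expr1n.
  by rewrite rmorph1 mulr1.
by case: e1 => -> ->; rewrite mulr0n !mulr0 sin0 cos0; ring.
Qed.

Lemma circle_parseval (R : realType) (g : {poly R[i]}) N : (size g <= N)%N ->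
  (2 * pi)^-1 *
    (\int[lebesgue_measure]_(t in `[0, 2 * pi]) Normc.normc g.[expi t] ^+ 2) =
  \sum_(v < N) Normc.normc g`_v ^+ 2 :> R.
Proof.
move=> gN.
have E t : Normc.normc g.[expi t] ^+ 2 = \sum_(p < N) \sum_(q < N)
    complex.Re (g`_p * (g`_q)^* * expi ((p%:R - q%:R) * t)).
  rewrite sqr_normc_Re (horner_coef_wide _ gN) rmorph_sum mulr_suml Re_sum.
  apply: eq_bigr => p _; rewrite mulr_sumr Re_sum; apply: eq_bigr => q _.
  congr (complex.Re _).
  rewrite rmorphM rmorphXn /= conj_expi !expiX mulrBl expiD mulrN.
  by ring.
under eq_Rintegral => t _ do rewrite E.
have H := has_circle_integral_sum R _ (index_enum 'I_N) xpredT _ _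
   (fun p _ => has_circle_integral_sum R _ (index_enum 'I_N) xpredT _ _
   (fun q _ => has_circle_integral_expi R (g`_p * (g`_q)^*) p q)).
rewrite (has_circle_integralE _ _ _ H) mulr_sumr; apply: eq_bigr => p _.
rewrite (bigD1 p) //= big1 ?addr0 => [|q qp]; last first.
  by rewrite val_eqE eq_sym (negbTE qp).
rewrite eqxx mulr1n mulKf; last first.
  by rewrite mulf_neq0 // gt_eqF // pi_gt0.
by rewrite sqr_normc_Re.
Qed.

(** The mean is nonnegative, so the p-th power undoes its real power 1/p. *)
Lemma circle_norm_expn (R : realType) (f : {poly R[i]}) p : (0 < p)%N ->
  circle_norm p%:R f ^+ p = (2 * pi)^-1 *
    (\int[lebesgue_measure]_(t in `[0, 2 * pi]) Normc.normc f.[expi t] ^+ p).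
Proof.
move=> p0; rewrite /circle_norm.
under eq_Rintegral => t _ do rewrite powR_mulrn ?normc_ge0 //.
set A := (X in X `^ _).
have A0 : 0 <= A.
  rewrite mulr_ge0 ?invr_ge0 ?mulr_ge0 ?pi_ge0 //.
  by apply: Rintegral_ge0 => t _; rewrite exprn_ge0 ?normc_ge0.
rewrite -powR_mulrn ?powR_ge0 // -powRrM mulVf ?powRr1 //.
by rewrite pnatr_eq0 -lt0n.
Qed.

Lemma circle_norm2 (R : realType) (f : {poly R[i]}) N : (size f <= N)%N ->
  circle_norm 2 f ^+ 2 = \sum_(m < N) Normc.normc f`_m ^+ 2.
Proof. by move=> fN; rewrite circle_norm_expn // (circle_parseval _ _ _ fN). Qed.

(** * The fourth norm through autocorrelations *)

(** The product f f~ of the overview. *)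
Definition corr_poly {C : numClosedFieldType} (a : nat -> C) (M : nat) : {poly C} :=
  (\poly_(m < M.+1) a m) * (\poly_(m < M.+1) (a (M - m)%N)^*).

Lemma size_corr_poly {C : numClosedFieldType} (a : nat -> C) M :
  (size (corr_poly a M) <= M + M.+1)%N.
Proof.
apply: (leq_trans (size_polyMleq _ _)).
have := size_poly M.+1 a; have := size_poly M.+1 (fun m => (a (M - m)%N)^*).
by lia.
Qed.

(** The product pairs a_j with the conjugate of a_(j-u); put j = m + u. For j < u the second factor
    is indexed beyond M and vanishes. *)
Lemma coef_corr_poly_ge {C : numClosedFieldType} (a : nat -> C) M u :
  (forall m, (M < m)%N -> a m = 0) ->
  (corr_poly a M)`_(M + u) = acorr a M.+1 u.
Proof.
move=> a0; rewrite coefM.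
rewrite -(big_mkord xpredT (fun j => (\poly_(m < M.+1) a m)`_j *
  (\poly_(m < M.+1) (a (M - m)%N)^*)`_(M + u - j))).
have uM : (u <= (M + u).+1)%N by lia.
rewrite (big_cat_nat (n := u)) //= big1_seq ?add0r; last first.
  move=> j; rewrite mem_index_iota => /andP[_ ju].
  by rewrite [X in _ * X]coef_poly ifF ?mulr0 //; lia.
rewrite -{1}[u]add0n big_addn (_ : ((M + u).+1 - u)%N = M.+1); last lia.
rewrite big_mkord /acorr; apply: eq_bigr => m _.
rewrite !coef_poly (_ : (M + u - (m + u) < M.+1)%N); last by lia.
rewrite (_ : (M - (M + u - (m + u)))%N = m); last by have := ltn_ord m; lia.
by case: ltnP => // Mm; rewrite (a0 (m + u)%N) // !mul0r.
Qed.

Lemma coef_corr_poly_le {C : numClosedFieldType} (a : nat -> C) M u :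
  (forall m, (M < m)%N -> a m = 0) -> (u <= M)%N ->
  (corr_poly a M)`_(M - u) = (acorr a M.+1 u)^*.
Proof.
move=> a0 uM; rewrite coefM /acorr rmorph_sum.
rewrite -(big_mkord xpredT (fun j => (\poly_(m < M.+1) a m)`_j *
  (\poly_(m < M.+1) (a (M - m)%N)^*)`_(M - u - j))).
rewrite -(big_mkord xpredT (fun m => (a (m + u)%N * (a m)^* )^*)).
rewrite [RHS](big_cat_nat (n := (M - u).+1)) //=; last by lia.
rewrite [X in _ = _ + X]big1_seq ?addr0; last first.
  move=> j; rewrite mem_index_iota => /andP[_ ju].
  by rewrite (a0 (j + u)%N) ?mul0r ?rmorph0 //; lia.
rewrite big_nat [RHS]big_nat; apply: eq_bigr => m mM.
rewrite !coef_poly !ifT; [|lia|lia].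
rewrite rmorphM /= conjCK mulrC; congr (_^* * _); congr (a _); lia.
Qed.

(** Each C_u with u > 0 occurs twice, once conjugated, and C_0 only once. *)
Lemma sum_sqr_corr_poly {C : numClosedFieldType} (a : nat -> C) M :
  (forall m, (M < m)%N -> a m = 0) ->
  \sum_(v < M + M.+1) `|(corr_poly a M)`_v| ^+ 2 =
  (\sum_(u < M.+1) `|acorr a M.+1 u| ^+ 2) *+ 2 - `|acorr a M.+1 0| ^+ 2.
Proof.
move=> a0; rewrite big_split_ord /=.
under [X in _ + X]eq_bigr => u _ do rewrite coef_corr_poly_ge //.
rewrite -(big_mkord xpredT (fun v => `|(corr_poly a M)`_v| ^+ 2)) big_nat_rev.
rewrite big_mkord (eq_bigr (fun u : 'I_M => `|acorr a M.+1 u.+1| ^+ 2)).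
  by rewrite big_ord_recl /=; ring.
by move=> u _; rewrite add0n coef_corr_poly_le ?norm_conjC.
Qed.

(** Reversing the coefficients gives f~(e^(it)) = e^(iMt) times the conjugate of f(e^(it)). *)
Lemma normc_corr_poly (R : realType) (a : nat -> R[i]) M t :
  Normc.normc (corr_poly a M).[expi t] =
  Normc.normc (\poly_(m < M.+1) a m).[expi t] ^+ 2.
Proof.
apply: complexI; rewrite sqr_normcE.
change (`|(corr_poly a M).[expi t]| =
   `|(\poly_(m < M.+1) a m).[expi t]| ^+ 2).
have e1 : `|expi t : R[i]| ^+ 2 = 1.
  by rewrite normCK conj_expi -expiD subrr expi0.
have e1' : `|expi t : R[i]| = 1.
  by apply/eqP; rewrite -(@pexpr_eq1 _ _ 2) ?normr_ge0 // e1.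
rewrite /corr_poly hornerM normrM expr2; congr (_ * _).
have -> : (\poly_(m < M.+1) (a (M - m)%N)^*).[expi t] =
   expi t ^+ M * ((\poly_(m < M.+1) a m).[expi t])^*.
  rewrite !horner_poly rmorph_sum mulr_sumr (reindex_inj rev_ord_inj) /=.
  apply: eq_bigr => m _; have mM : (m <= M)%N by rewrite -ltnS.
  rewrite subSS subKn // rmorphM rmorphXn /= conj_expi mulrCA; congr (_ * _).
  rewrite !expiX -expiD natrB //; congr expi; ring.
by rewrite normrM normrX e1' expr1n mul1r norm_conjC.
Qed.

(** |f|^4 = |f f~|^2 on the circle, so [circle_parseval] applies to [corr_poly]. The equation lives
    in R[i], where the moduli of [acorr] take their values. *)
Lemma circle_norm4 (R : realType) (a : nat -> R[i]) M :
  (forall m, (M < m)%N -> a m = 0) ->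
  (circle_norm 4 (\poly_(m < M.+1) a m) ^+ 4)%:C%C =
  (\sum_(u < M.+1) `|acorr a M.+1 u| ^+ 2) *+ 2 - `|acorr a M.+1 0| ^+ 2.
Proof.
move=> a0; rewrite circle_norm_expn // -sum_sqr_corr_poly //.
under eq_Rintegral => t _ do rewrite (exprM _ 2 2) -normc_corr_poly.
rewrite (circle_parseval _ _ _ (size_corr_poly a M)) rmorph_sum.
by apply: eq_bigr => v _; rewrite /= sqr_normcE.
Qed.

(** * Exact norms of h_n *)

Lemma expiB1 (R : realType) (t : R) :
  `|expi (t *+ 2) - 1 : R[i]| ^+ 2 = (4 * sin t ^+ 2)%:C%C.
Proof.
rewrite -sqr_normcE; congr (_%:C)%C; rewrite sqr_normc_Re /expi.
rewrite cos_mulr2n sin_mulr2n /=.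
have := cos2Dsin2 t; set c := cos t; set s := sin t => cs.
have -> : c ^+ 2 = 1 - s ^+ 2 by rewrite -cs; ring.
rewrite oppr0 addr0 mulrN opprK.
have -> : (c * s *+ 2) * (c * s *+ 2) = 4 * (c ^+ 2 * s ^+ 2) by ring.
have -> : c ^+ 2 = 1 - s ^+ 2 by rewrite -cs; ring.
by ring.
Qed.

Definition zeta (R : realType) (n : nat) : R[i] := expi (2 * pi / n%:R).

Lemma zetaXB1 (R : realType) n s :
  `|zeta R n ^+ s - 1| ^+ 2 = (4 * sin (pi / n%:R * s%:R) ^+ 2)%:C%C.
Proof. by rewrite -expiB1 /zeta expiX; congr (`|expi _ - 1| ^+ 2); ring. Qed.

(** By [zetaXB1], zeta^s = 1 exactly when sin(pi s/n) = 0, and 0 < pi s/n < pi for 0 < s < n. *)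
Lemma zeta_prim (R : realType) n : (0 < n)%N -> n.-primitive_root (zeta R n).
Proof.
move=> n0; apply/andP; split=> //; apply/forallP => i; apply/eqP.
rewrite unity_rootE -subr_eq0 -normr_eq0 -sqrf_eq0 zetaXB1.
have nR : 0 < n%:R :> R by rewrite ltr0n.
have [->|ni] := eqVneq i.+1 n.
  by rewrite (divfK (lt0r_neq0 nR)) sinpi expr0n mulr0 eqxx.
apply/negbTE; rewrite (inj_eq (@complexI _)) mulf_neq0 // expf_neq0 // gt_eqF //.
apply: sin_gt0_pi; rewrite mulr_gt0 ?divr_gt0 ?pi_gt0 //=.
by rewrite mulrAC ltr_pdivrMr // ltr_pM2l ?pi_gt0 // ltr_nat ltn_neqAle ni ltn_ord.
Qed.

Lemma h_poly (R : realType) n :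
  h R n = \poly_(m < n * n) gauss_seq (zeta R n) n m.
Proof.
rewrite poly_def (sum_blocks (fun m => gauss_seq (zeta R n) n m *: 'X^m)) /h big_mkord.
apply: eq_bigr => j _; rewrite big_mkord; apply: eq_bigr => k _.
by rewrite gauss_seqE // ltn_ord /zeta expiX; congr (expi _ *: _); ring.
Qed.

(* The junk value [0^-1 = 0] makes [invsin2 n 0 = 0], matching [pole z 0 = 0]. *)
Definition invsin2 (R : realType) (n s : nat) : R := (sin (pi / n%:R * s%:R) ^+ 2)^-1.

Lemma sqr_pole_zeta (R : realType) n s :
  `|pole (zeta R n) s| ^+ 2 = (invsin2 R n s / 4)%:C%C.
Proof.
rewrite /pole normfV exprVn zetaXB1 -fmorphV; congr (_%:C)%C.
by rewrite invfM mulrC.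
Qed.

(** c_r - c_(r+1) = zeta^r (zeta - 1) c_r c_(r+1), with both denominators nonzero for 0 < r < n -
    1. *)
Lemma sqr_poleB_zeta (R : realType) n r : (0 < r)%N -> (r.+1 < n)%N ->
  `|pole (zeta R n) r - pole (zeta R n) r.+1| ^+ 2 =
  (sin (pi / n%:R) ^+ 2 * (invsin2 R n r * invsin2 R n r.+1) / 4)%:C%C.
Proof.
move=> r0 rn; have n0 : (0 < n)%N by lia.
have zn := zeta_prim R n n0; set z := zeta R n.
have nz j : (0 < j)%N -> (j < n)%N -> z ^+ j - 1 != 0.
  move=> j0 jn; rewrite subr_eq0 -(expr0 z) (eq_prim_root_expr zn).
  by rewrite mod0n modn_small // -lt0n.
have -> : pole z r - pole z r.+1 = z ^+ r * (z - 1) * (pole z r * pole z r.+1).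
  rewrite /pole exprSr; field.
  by rewrite !nz //; [rewrite -exprSr nz|lia].
have z1 : `|z| = 1 := root_norm1 z n n0 (prim_expr_order zn).
rewrite !normrM normrX z1 expr1n mul1r !exprMn !sqr_pole_zeta -[z in `|z - 1|]expr1.
rewrite zetaXB1 mulr1 -!rmorphM; congr (_%:C)%C; by field.
Qed.

Lemma acorr_gauss0 (R : realType) n : (0 < n)%N ->
  acorr (gauss_seq (zeta R n) n) (n * n) 0 = (n%:R ^+ 2)%:C%C.
Proof.
move=> n0; have zn := zeta_prim R n n0.
have z1 : `|zeta R n| = 1 := root_norm1 _ n n0 (prim_expr_order zn).
rewrite /acorr (eq_bigr (fun=> 1)).
  by rewrite sumr_const card_ord rmorphXn rmorph_nat -natrX -mulnn.
move=> m _; rewrite addn0 -normCK /gauss_seq ltn_ord normrX z1.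
by rewrite !expr1n.
Qed.

(** The n^2 coefficients all have modulus 1. *)
Lemma circle_norm2_h (R : realType) n : circle_norm 2 (h R n) = n%:R.
Proof.
apply/eqP; rewrite -(@eqrXn2 _ 2) ?powR_ge0 ?ler0n //.
have sz : (size (h R n) <= n * n)%N by rewrite h_poly size_poly.
rewrite (circle_norm2 _ _ _ sz); apply/eqP; apply: complexI.
have [->|n0] := posnP n.
  by rewrite big_ord0 expr0n.
rewrite -acorr_gauss0 // rmorph_sum /acorr; apply: eq_bigr => m _.
by rewrite /= sqr_normcE h_poly coef_poly ltn_ord addn0 normCK.
Qed.

(** The sum of |C_u|^2 over u > 0, divided by n: one summand per pair of equal rows, plus the middle
    row for odd n. *)
Definition half_sum (R : realType) n : R :=
  \sum_(r < n./2) (invsin2 R n r.+1 +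
     sin (pi / n%:R) ^+ 2 * (invsin2 R n r * invsin2 R n r.+1) * r%:R) +
  (sin (pi / n%:R) ^+ 2 * (invsin2 R n n./2 * invsin2 R n n./2.+1) * n./2%:R / 2)
    *+ odd n.

Lemma circle_norm4_h (R : realType) n : (0 < n)%N ->
  circle_norm 4 (h R n) ^+ 4 = n%:R ^+ 4 + 2 * n%:R * half_sum R n.
Proof.
move=> n0; have zn := zeta_prim R n n0.
have nn0 : (0 < n * n)%N by rewrite muln_gt0 n0.
apply: complexI; rewrite h_poly -(prednK nn0) circle_norm4; last first.
  by move=> m; rewrite (ltn_predK nn0) /gauss_seq ltnNge => ->.
rewrite (prednK nn0) sum_sqr_acorr_gauss // sum_rows_gauss //.
rewrite acorr_gauss0 //.
set T := (X in _ + n%:R * X).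
have TE : T = (half_sum R n)%:C%C.
  rewrite /T /half_sum rmorphD rmorph_sum /=; congr (_ + _).
    apply: eq_bigr => r _; rewrite sqr_pole_zeta.
    (* [sqr_poleB_zeta] needs r > 0; at r = 0 the difference term has multiplicity 0. *)
    have [r0|r0] := posnP r.
      rewrite r0 mulr0n addr0 mulr0 addr0 -rmorphMn; congr (_%:C)%C.
      by rewrite -mulr_natr; field.
    rewrite sqr_poleB_zeta //; last by have := ltn_ord r; lia.
    rewrite -rmorphMn -rmorphD -rmorphMn; congr (_%:C)%C.
    by rewrite -(mulr_natr _ r) -(mulr_natr _ 4); field.
  have [on|_] := boolP (odd n); last by rewrite !mulr0n.
  (* Here n = 1, and the middle term is 0 on both sides. *)
  rewrite !mulr1n; have [m0|m0] := posnP n./2.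
    by rewrite m0 double0 mulr0n mulr0 mul0r.
  rewrite sqr_poleB_zeta //; last by have := odd_double_half n; rewrite on; lia.
  rewrite -rmorphMn; congr (_%:C)%C.
  by rewrite -mulr_natr -mul2n natrM; field.
rewrite TE ger0_norm; last by rewrite ler0c exprn_ge0.
rewrite -(rmorph_nat (real_complex R) n) -rmorphXn /= -!rmorphM -rmorphD.
rewrite -rmorphMn -rmorphB; congr (_%:C)%C; ring.
Qed.

(** * Bounds for the sine *)

Lemma le_of_derive_ge0 (R : realType) (f df : R -> R) (b : R) : 0 <= b ->
  (forall x, is_derive x (1 : R) f (df x)) ->
  (forall x, 0 <= x <= b -> 0 <= df x) -> f 0 <= f b.
Proof.
move=> b0 dF df0; rewrite -subr_ge0.
have [|c cb ->] := @MVT_segment R f df 0 b b0 (fun x _ => dF x).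
  apply: continuous_subspaceT => x.
  apply: differentiable_continuous; apply/derivable1_diffP.
  by have [] := dF x.
by rewrite subr0 mulr_ge0 // df0 // -in_itv.
Qed.

Lemma sin_le_id (R : realType) (x : R) : 0 <= x -> sin x <= x.
Proof.
move=> x0; rewrite -subr_ge0.
have := @le_of_derive_ge0 R (fun x => x - sin x) (fun x => 1 - cos x) x x0.
rewrite sin0 subrr; apply=> t _.
by rewrite subr_ge0 cos_le1.
Qed.

Lemma id_cos_le_sin (R : realType) (x : R) : 0 <= x <= pi -> x * cos x <= sin x.
Proof.
move=> /andP[x0 xpi]; rewrite -subr_ge0.
have := @le_of_derive_ge0 R (fun x => sin x - x * cos x) (fun x => x * sin x) x x0.
rewrite sin0 mul0r subrr; apply=> [t|t /andP[t0 tx]].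
  by apply: is_derive_eq; rewrite /GRing.scale /=; ring.
by rewrite mulr_ge0 // sin_ge0_pi // t0 (le_trans tx).
Qed.

(** The lower bound is sin x <= x. Squaring x cos x <= sin x gives x^2 (1 - sin^2 x) <= sin^2 x;
    division by x^2 sin^2 x gives the upper one. *)
Lemma inv_sin2_bounds (R : realType) (x : R) : 0 < x <= pi / 2 ->
  (x ^+ 2)^-1 <= (sin x ^+ 2)^-1 <= (x ^+ 2)^-1 + 1.
Proof.
move=> /andP[x0 xpi]; have pi0 : 0 < pi :> R := pi_gt0 R.
have xpi' : x < pi by lra.
have s0 : 0 < sin x by rewrite sin_gt0_pi // x0.
have s20 : 0 < sin x ^+ 2 by rewrite exprn_gt0.
have x20 : 0 < x ^+ 2 by rewrite exprn_gt0.
rewrite lef_pV2 ?posrE // ler_pXn2r ?nnegrE ?(ltW x0) ?(ltW s0) //.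
rewrite sin_le_id ?(ltW x0) //=.
have c0 : 0 <= cos x by rewrite cos_ge0_pihalf //; lra.
have xc : x * cos x <= sin x by rewrite id_cos_le_sin // !ltW.
have : (x * cos x) ^+ 2 <= sin x ^+ 2.
  by rewrite ler_pXn2r ?nnegrE ?mulr_ge0 ?(ltW x0) ?(ltW s0).
rewrite exprMn cos2sin2 => H.
rewrite -(ler_pM2r s20) mulVf ?gt_eqF // -(ler_pM2l x20) mulr1.
by rewrite mulrA mulrDr mulfV ?gt_eqF // mulr1; lra.
Qed.

(** * Asymptotics of [half_sum] *)

(** Telescoping, with the entry 1 at r = 0 for the main term of row 0. *)
Lemma sum_inv_pronic (R : realFieldType) m :
  \sum_(r < m.+1) (if r == 0%N :> nat then 1 else (r%:R * r.+1%:R)^-1) =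
  2 - m.+1%:R^-1 :> R.
Proof.
elim: m => [|m IH]; first by rewrite big_ord1 /= invr1; ring.
rewrite big_ord_recr IH /= -!natr1.
have m1 : m%:R + 1 != 0 :> R by rewrite natr1 pnatr_eq0.
have m2 : m%:R + 1 + 1 != 0 :> R by rewrite !natr1 pnatr_eq0.
by field; rewrite m1 m2.
Qed.

(** Used with c = pi/n, s = sin^2 c, and e, f the errors in replacing 1/sin^2 y by 1/y^2. The main
    term is 1/(r+1)^2 + r/(r^2 (r+1)^2) = 1/(r(r+1)). *)
Lemma summand_bounds (R : realFieldType) (r c e f s : R) : 1 <= r -> 0 < c ->
  c <= 1 -> r * c <= 2 -> 0 <= e <= 1 -> 0 <= f <= 1 ->
  c ^+ 2 * (1 - c ^+ 2) <= s <= c ^+ 2 ->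
  (1 - c ^+ 2) * (r * (r + 1))^-1 <=
  c ^+ 2 * ((((c * (r + 1)) ^+ 2)^-1 + f) +
    s * ((((c * r) ^+ 2)^-1 + e) * (((c * (r + 1)) ^+ 2)^-1 + f)) * r) <=
  (r * (r + 1))^-1 + 5 * c ^+ 2.
Proof.
move=> r1 c0 c1 rc /andP[e0 e1] /andP[f0 f1] /andP[s0 s1].
have r0 : 0 < r by lra.
have r10 : 0 < r + 1 by lra.
have c20 : 0 < c ^+ 2 by rewrite exprn_gt0.
have c21 : c ^+ 2 <= 1 by rewrite exprn_ile1 // ltW.
pose q := s / c ^+ 2; have sE : s = c ^+ 2 * q by rewrite mulrC divfK // gt_eqF.
have q0 : 1 - c ^+ 2 <= q by rewrite -(ler_pM2l c20) -sE.
have q1 : q <= 1 by rewrite -(ler_pM2l c20) -sE mulr1.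
pose a := r^-1; pose b := (r + 1)^-1.
have a0 : 0 < a by rewrite invr_gt0.
have b0 : 0 < b by rewrite invr_gt0.
have ra : r * a = 1 by rewrite mulfV // gt_eqF.
have rb : (r + 1) * b = 1 by rewrite mulfV // gt_eqF.
have a1 : a <= 1 by rewrite invf_le1.
have rb2 : r * b ^+ 2 <= 1.
  have : b <= 1 by rewrite invf_le1 //; lra.
  have : r * b <= 1 by lra.
  move=> h1 h2; rewrite expr2 mulrA -[1]mulr1 ler_pM ?mulr_ge0 // ltW //.
have -> : (r * (r + 1))^-1 = b ^+ 2 + r * a ^+ 2 * b ^+ 2.
  by rewrite /a /b; field; rewrite !gt_eqF.
set X := (X in _ <= X <= _).
have -> : X = b ^+ 2 + c ^+ 2 * f
    + q * (r * ((a ^+ 2 + c ^+ 2 * e) * (b ^+ 2 + c ^+ 2 * f))).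
  by rewrite /X sE /a /b; field; rewrite !gt_eqF.
have b20 : 0 <= b ^+ 2 by rewrite sqr_ge0.
have a20 : 0 <= a ^+ 2 by rewrite sqr_ge0.
have cf0 : 0 <= c ^+ 2 * f by rewrite mulr_ge0 // ltW.
have ce0 : 0 <= c ^+ 2 * e by rewrite mulr_ge0 // ltW.
have cf1 : c ^+ 2 * f <= c ^+ 2 by rewrite ler_piMr // ltW.
have ce1 : c ^+ 2 * e <= c ^+ 2 by rewrite ler_piMr // ltW.
have q00 : 0 <= q by lra.
apply/andP; split.
  have h : r * (a ^+ 2 * b ^+ 2) <=
     r * ((a ^+ 2 + c ^+ 2 * e) * (b ^+ 2 + c ^+ 2 * f)).
    by rewrite ler_pM2l // ler_pM // lerDl.
  have h0 : 0 <= r * (a ^+ 2 * b ^+ 2) by rewrite !mulr_ge0 // ltW.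
  have h1 : (1 - c ^+ 2) * (r * (a ^+ 2 * b ^+ 2)) <=
     q * (r * ((a ^+ 2 + c ^+ 2 * e) * (b ^+ 2 + c ^+ 2 * f))).
    by rewrite ler_pM // subr_ge0.
  have h2 : (1 - c ^+ 2) * b ^+ 2 <= b ^+ 2 by rewrite ler_piMl //; lra.
  by rewrite mulrDr -[r * _ * _]mulrA; lra.
have h : r * ((a ^+ 2 + c ^+ 2 * e) * (b ^+ 2 + c ^+ 2 * f)) <=
     r * ((a ^+ 2 + c ^+ 2) * (b ^+ 2 + c ^+ 2)).
  by rewrite ler_pM2l // ler_pM ?addr_ge0 // lerD2l.
have h1 : q * (r * ((a ^+ 2 + c ^+ 2 * e) * (b ^+ 2 + c ^+ 2 * f))) <=
     r * ((a ^+ 2 + c ^+ 2) * (b ^+ 2 + c ^+ 2)).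
  apply: le_trans h; rewrite ler_piMl // !mulr_ge0 ?addr_ge0 // ltW //.
have h2 : r * ((a ^+ 2 + c ^+ 2) * (b ^+ 2 + c ^+ 2)) =
   r * a ^+ 2 * b ^+ 2 + c ^+ 2 * ((r * a) * a + r * b ^+ 2 + (r * c) * c).
  by ring.
have h3 : (r * c) * c <= 2.
  by rewrite -[2]mulr1 ler_pM ?mulr_ge0 // ltW.
(* The bracket is at most 1 + 1 + 2; with c^2 f <= c^2 this makes the constant 5. *)
have h4 : c ^+ 2 * ((r * a) * a + r * b ^+ 2 + (r * c) * c) <= c ^+ 2 * 4.
  by rewrite ler_pM2l // ra mul1r; lra.
by lra.
Qed.

Lemma half_sum_bounds (R : realType) n (c := pi / n%:R : R) : (4 <= n)%N ->
  2 - 5 * c <= c ^+ 2 * half_sum R n <= 2 + 26 * c.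
Proof.
move=> n4; have pi2 := pi_ge2 R; have pi4 := pihalf_lt2 R.
have nE := odd_double_half n; have no : (odd n <= 1)%N by case: (odd n).
set m := n./2 in nE *.
have m0 : (0 < m)%N by lia.
have nR : 4 <= n%:R :> R by rewrite (ler_nat _ 4).
have cn : c * n%:R = pi by rewrite divfK // gt_eqF //; lra.
have c0 : 0 < c by rewrite divr_gt0 //; lra.
have c1 : c <= 1 by rewrite ler_pdivrMr; lra.
(* All angles c r with r <= m lie in (0, pi/2], and n <= 3m bounds c m from below. *)
have cm2 : 2 * (c * m%:R) <= pi.
  rewrite mulrCA -cn ler_pM2l // -natrM ler_nat; lia.
have cm3 : pi <= 3 * (c * m%:R).
  rewrite mulrCA -cn ler_pM2l // -natrM ler_nat; lia.
have bnd r : (0 < r)%N -> (r <= m)%N -> exists2 e : R, 0 <= e <= 1 &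
    invsin2 R n r = ((c * r%:R) ^+ 2)^-1 + e.
  move=> r0 rm; have r0R : 0 < r%:R :> R by rewrite ltr0n.
  have rmR : c * r%:R <= c * m%:R by rewrite ler_pM2l // ler_nat.
  have /inv_sin2_bounds/andP[h1 h2] : 0 < c * r%:R <= pi / 2.
    by rewrite mulr_gt0 //=; lra.
  exists (invsin2 R n r - ((c * r%:R) ^+ 2)^-1); last by ring.
  by rewrite /invsin2 -/c; lra.
have c20 : 0 < c ^+ 2 by rewrite exprn_gt0.
have c21 : c ^+ 2 <= c by rewrite expr2 ler_piMr // ltW.
(* From sin^2 c >= c^2/(1 + c^2) and (1 + c^2)(1 - c^2) <= 1. *)
have sc : c ^+ 2 * (1 - c ^+ 2) <= sin c ^+ 2 <= c ^+ 2.
  have /inv_sin2_bounds/andP[h1 h2] : 0 < c <= pi / 2 by rewrite c0 /=; lra.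
  have s20 : 0 < sin c ^+ 2 by rewrite exprn_gt0 // sin_gt0_pi //; lra.
  move: h1; rewrite lef_pV2 ?posrE // => ->; rewrite andbT.
  have := ler_wpM2r (ltW s20) h2; rewrite mulVf ?gt_eqF // => h3.
  have := ler_wpM2r (ltW c20) h3.
  rewrite mul1r mulrAC mulrDl mulVf ?gt_eqF // => h4.
  apply: (@le_trans _ _ ((1 + 1 * c ^+ 2) * sin c ^+ 2 * (1 - c ^+ 2))).
    by rewrite ler_wpM2r //; lra.
  rewrite mulrAC -[leRHS]mul1r ler_wpM2r ?(ltW s20) //.
  have := sqr_ge0 (c ^+ 2); rewrite mul1r mulrDl; lra.
have term (r : 'I_m) :
   (1 - c ^+ 2) * (if r == 0%N :> nat then 1 else (r%:R * r.+1%:R)^-1) <=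
   c ^+ 2 * (invsin2 R n r.+1 +
     sin c ^+ 2 * (invsin2 R n r * invsin2 R n r.+1) * r%:R) <=
   (if r == 0%N :> nat then 1 else (r%:R * r.+1%:R)^-1) + 5 * c ^+ 2.
  have rm := ltn_ord r.
  have [f f01 ->] := bnd r.+1 isT rm.
  case: posnP => [->|r0].
    have h : c ^+ 2 * (c ^+ 2)^-1 = 1 by rewrite mulfV ?gt_eqF.
    have h0 : 0 <= c ^+ 2 * f by rewrite mulr_ge0 ?(ltW c20) //; lra.
    have h1 : c ^+ 2 * f <= c ^+ 2 by rewrite ler_piMr ?(ltW c20) //; lra.
    by rewrite mulr0 addr0 !mulr1 mulrDr h; lra.
  have [e e01 ->] := bnd r r0 (ltnW rm).
  rewrite -[r.+1%:R]natr1; apply: summand_bounds => //.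
    by rewrite ler1n.
  have : c * r%:R <= c * m%:R by rewrite ler_pM2l // ler_nat ltnW.
  by rewrite [r%:R * c]mulrC; lra.
have tau : \sum_(r < m) (if r == 0%N :> nat then 1 else (r%:R * r.+1%:R)^-1) =
   2 - m%:R^-1 :> R by rewrite -(prednK m0) sum_inv_pronic.
have mR : 1 <= m%:R :> R by rewrite ler1n.
have mV : m%:R^-1 <= 3 / 2 * c.
  have mi : 0 < m%:R^-1 :> R by rewrite invr_gt0; lra.
  have : m%:R^-1 * 2 <= m%:R^-1 * (3 * (c * m%:R)) by rewrite ler_pM2l //; lra.
  have -> : m%:R^-1 * (3 * (c * m%:R)) = 3 * c by field; rewrite gt_eqF //; lra.
  by lra.
have mV0 : 0 <= m%:R^-1 :> R by rewrite invr_ge0; lra.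
(* With n = 2m + 1 the angles c m and c (m+1) add up to pi, so their sines agree. As c m >= 2/3, S
   <= 9/4 + 1 <= 4; as c m <= 2, the product is at most 8 c (c m) <= 16 c. *)
have mid : odd n -> 0 <= c ^+ 2 * (sin c ^+ 2 *
    (invsin2 R n m * invsin2 R n m.+1) * m%:R / 2) <= 16 * c.
  move=> on; have -> : invsin2 R n m.+1 = invsin2 R n m.
    rewrite /invsin2 -/c; congr (_ ^+ 2)^-1.
    have -> : c * m.+1%:R = pi - c * m%:R.
      have nm : n%:R = 2 * m%:R + 1 :> R.
        by rewrite -{1}nE on -mul2n natrD natrM addrC.
      by rewrite -cn nm -natr1; ring.
    by rewrite sinB sinpi cospi; ring.
  have [e e01 E] := bnd m m0 (leqnn m).
  set S := invsin2 R n m in E *.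
  have S0 : 0 <= S by rewrite /S /invsin2 invr_ge0 sqr_ge0.
  have S4 : S <= 4.
    have h : (2 / 3) ^+ 2 <= (c * m%:R) ^+ 2 :> R.
      rewrite ler_pXn2r ?nnegrE //; lra.
    have : ((c * m%:R) ^+ 2)^-1 <= ((2 / 3) ^+ 2)^-1.
      by rewrite lef_pV2 ?posrE ?exprn_gt0 //; lra.
    have -> : ((2 / 3) ^+ 2)^-1 = 9 / 4 :> R by field.
    by lra.
  have SS : S * S <= 16.
    by apply: (le_trans (ler_pM S0 S0 S4 S4)); lra.
  have /andP[s0 s1] := sc.
  have s00 : 0 <= sin c ^+ 2 := sqr_ge0 _.
  have h2 : 0 <= 2^-1 :> R by rewrite invr_ge0.
  set Y := sin c ^+ 2 * (S * S) * m%:R / 2.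
  have Y0 : 0 <= Y.
    exact: mulr_ge0 (mulr_ge0 (mulr_ge0 s00 (mulr_ge0 S0 S0)) (ler0n _ m)) h2.
  have Y1 : Y <= c * 16 * m%:R / 2.
    apply: ler_wpM2r => //; apply: ler_wpM2r => //.
    exact: ler_pM s00 (mulr_ge0 S0 S0) (le_trans s1 c21) SS.
  apply/andP; split; first exact: mulr_ge0 (ltW c20) Y0.
  apply: le_trans (ler_pM (ltW c20) Y0 c21 Y1) _.
  have : c * (c * m%:R) <= c * 2 by rewrite ler_pM2l //; lra.
  have -> : c * (c * 16 * m%:R / 2) = 8 * (c * (c * m%:R)) by field.
  by lra.
rewrite /half_sum -/m -/c mulrDr mulr_sumr.
set A := \sum_(_ < _) _; set B := c ^+ 2 * _.
have B01 : 0 <= B <= 16 * c.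
  rewrite /B; case: (odd n) mid => [/(_ isT)|_]; first by rewrite mulr1n.
  by rewrite mulr0n mulr0; lra.
have A1 : (1 - c ^+ 2) * (2 - m%:R^-1) <= A.
  by rewrite -tau mulr_sumr; apply: ler_sum => r _; have /andP[] := term r.
have A2 : A <= 2 - m%:R^-1 + 5 * c ^+ 2 * m%:R.
  have -> : 5 * c ^+ 2 * m%:R = \sum_(r < m) 5 * c ^+ 2.
    by rewrite sumr_const card_ord mulr_natr.
  by rewrite -tau -big_split; apply: ler_sum => r _; have /andP[] := term r.
have cc : c ^+ 2 * m%:R <= 2 * c.
  by rewrite expr2 -mulrA mulrC ler_pM2r //; lra.
have cm : 0 <= c ^+ 2 * m%:R^-1 by rewrite mulr_ge0 // ltW.
move: A1; rewrite mulrBr mulrBl mulrBl => A1.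
(* Upper bound: 5 c^2 m <= 10 c plus 16 c for B. Lower bound: the loss is at most 1/m + 2 c^2 <= 7/2
   c. *)
by lra.
Qed.

(** * Passage to the limit *)

Theorem theorem2 (R : realType) :
  (fun n : nat =>
     (circle_norm 4 (h R n) ^+ 4 - circle_norm 2 (h R n) ^+ 4)
       / circle_norm 2 (h R n) ^+ 3)
    @ \oo --> (4 / pi ^+ 2 : R).
Proof.
have pi0 : pi != 0 :> R by rewrite gt_eqF // pi_gt0.
have cvgc : (fun n : nat => pi / n%:R : R) @ \oo --> (0 : R).
  rewrite -(mulr0 pi); apply: cvgM; first exact: cvg_cst.
  by rewrite -cvg_shiftS; exact: cvg_harmonic.
have cvgl (k : R) : (fun n : nat => 2 / pi ^+ 2 * (2 + k * (pi / n%:R))) @ \oo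
    --> (4 / pi ^+ 2 : R).
  have -> : 4 / pi ^+ 2 = 2 / pi ^+ 2 * (2 + k * 0) :> R.
    by rewrite mulr0 addr0; move: (pi : R) pi0 => p p0; field.
  apply: cvgM; first exact: cvg_cst.
  apply: cvgD; first exact: cvg_cst.
  by apply: cvgM; first exact: cvg_cst.
(* The slopes -5 and 26 are those of [half_sum_bounds]. *)
apply: squeeze_cvgr (cvgl (- 5)) (cvgl 26).
near=> n.
have n4 : (4 <= n)%N by near: n; exact: nbhs_infty_ge.
have n0 : n%:R != 0 :> R by rewrite pnatr_eq0; lia.
(* The quotient is 2 [half_sum] / n^2, rewritten with the factor (pi/n)^2 that [half_sum_bounds]
   controls. *)
have ratio (A B : R) : A ^+ 4 = n%:R ^+ 4 + 2 * n%:R * half_sum R n ->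
    B = n%:R -> (A ^+ 4 - B ^+ 4) / B ^+ 3 =
    2 / pi ^+ 2 * ((pi / n%:R) ^+ 2 * half_sum R n).
  move=> -> ->; move: (half_sum R n) (pi : R) pi0 => H p p0.
  by field; rewrite n0 p0.
have n1 : (0 < n)%N by lia.
rewrite (ratio _ _ (circle_norm4_h R n n1) (circle_norm2_h R n)).
have k0 : 0 < 2 / pi ^+ 2 :> R by rewrite divr_gt0 // exprn_gt0 // pi_gt0.
by rewrite !ler_pM2l // mulNr half_sum_bounds.
Unshelve. all: end_near.
Qed.
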